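(* Let $G$ be a commutative group, let $R$ be a $G$-graded commutative ring, and let $M$ and $N$ be $G$-graded $R$-modules. Let $$\mu_{M,N}\colon M\otimes_RN\to\mathrm{Hom}^G_R(\mathrm{Hom}^G_R(M,R),N),\quad x\otimes y\mapsto(u\mapsto u(x)y)$$ be the canonical morphism in $\mathrm{Mod}^G(R)$. If $M$ and $N$ are projective, then $\mu_{M,N}$ is a monomorphism. If $M$ is projective and of finite type, then $\mu_{M,N}$ is an isomorphism.
   Context: All groups and rings are commutative (rings unital). $\mathrm{Mod}^G(R)$ is the category of $G$-graded $R$-modules with degree-preserving $R$-linear maps; $M(g)$ is the shift, $M(g)_{g'}=M_{g+g'}$. The tensor product $M\otimes_RN$ is graded with $x\otimes y$ in degree $\deg x+\deg y$. $\mathrm{Hom}^G_R(M,N)=\bigoplus_{g\in G}\mathrm{Hom}_{\mathrm{Mod}^G(R)}(M,N(g))$, a $G$-graded $R$-module. A $G$-graded $R$-module $M$ is of finite type if there is an epimorphism $F\to M$ in $\mathrm{Mod}^G(R)$ with $F\cong\bigoplus_{i\in I}R(g_i)$ for a finite family $(g_i)_{i\in I}$ in $G$; it is projective if $\mathrm{Hom}_{\mathrm{Mod}^G(R)}(M,\bullet)$ is exact. The morphism $\mu_{M,N}$ is the paper's $\mu^{\mathrm{Id}_R}_{M,N}$. *)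

(* Defs.v *)
From HB Require Import structures.
From mathcomp Require Import all_boot all_algebra.
From mathcomp Require Import finmap.
From mathcomp Require Import boolp classical_sets functions cardinality fsbigop.

Set Implicit Arguments.
Unset Strict Implicit.
Unset Printing Implicit Defensive.
Import GRing.Theory.
Local Open Scope classical_set_scope.
Local Open Scope ring_scope.
Local Open Scope quotient_scope.

Section DirectSum.
Variables (G : choiceType) (V : zmodType).
Implicit Types (W : G -> set V) (c : G -> V).

Definition is_subgroup (A : set V) : Prop :=
  A 0 /\ forall x y, A x -> A y -> A (x - y).

(* c is the finitely supported family of components of x: the last condition
   is meaningful because of the first, a sum over [set: G] being 0 by convention
   when its support is infinite. *)
Definition decomposition W c (x : V) : Prop :=
  [/\ finite_set [set g | c g <> 0], forall g, W g (c g)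
    & x = \sum_(g \in [set: G]) c g].

Definition is_direct_sum W : Prop :=
  (forall g, is_subgroup (W g)) /\
  forall x, exists! c, decomposition W c x.

Lemma subgroupN (A : set V) x : is_subgroup A -> A x -> A (- x).
Proof. by move=> [A0 AB] Ax; rewrite -sub0r; apply: AB. Qed.

Lemma subgroupD (A : set V) x y : is_subgroup A -> A x -> A y -> A (x + y).
Proof.
by move=> hA Ax Ay; rewrite -[y]opprK; apply: hA.2 => //; apply: subgroupN.
Qed.

Lemma subgroup_sum (A : set V) (I : Type) (s : seq I) (F : I -> V) :
  is_subgroup A -> (forall i, A (F i)) -> A (\sum_(i <- s) F i).
Proof.
move=> hA AF; elim: s => [|i s ih]; first by rewrite big_nil; case: hA.
by rewrite big_cons; apply: subgroupD.
Qed.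

Lemma fsum_seq c (s : seq G) : uniq s -> (forall g, g \notin s -> c g = 0) ->
  \sum_(g \in [set: G]) c g = \sum_(g <- s) c g.
Proof.
move=> us cs; rewrite (fsbigE s) // => [|g _]; last exact: cs.
by under eq_bigl do rewrite in_setT.
Qed.

Lemma decI W c (s : seq G) : uniq s -> (forall g, g \notin s -> c g = 0) ->
  (forall g, W g (c g)) -> decomposition W c (\sum_(g <- s) c g).
Proof.
move=> us cs Vc; split=> //; last by rewrite (fsum_seq us cs).
apply: (@sub_finite_set _ _ [set` s]); last exact: finite_seq.
by move=> g /= cg; apply: contrapT => /negP /cs.
Qed.

Lemma decE W c x : decomposition W c x ->
  exists s : seq G, [/\ uniq s, forall g, g \notin s -> c g = 0
    & x = \sum_(g <- s) c g].
Proof.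
move=> [fc Vc ->]; case/finite_seqP: (fc) => s es.
have cs g : g \notin undup s -> c g = 0.
  rewrite mem_undup => gs; apply: contrapT => cg.
  have : [set` s] g by rewrite -es.
  by rewrite /= (negbTE gs).
exists (undup s); split; [exact: undup_uniq|exact: cs|].
by apply: fsum_seq => //; apply: undup_uniq.
Qed.

Lemma sum_widen c (s t : seq G) : uniq s -> uniq t -> {subset s <= t} ->
  (forall g, g \notin s -> c g = 0) -> \sum_(g <- s) c g = \sum_(g <- t) c g.
Proof.
move=> us ut st cs; rewrite -(fsum_seq us cs) -(fsum_seq ut) // => g gt.
by apply: cs; apply: contra gt; apply: st.
Qed.

Lemma decD W c d x y : (forall g, is_subgroup (W g)) ->
  decomposition W c x -> decomposition W d y ->
  decomposition W (fun g => c g + d g) (x + y).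
Proof.
move=> hV hc hd; have [_ Vc _] := hc; have [_ Vd _] := hd.
have [s [us cs ->]] := decE hc; have [t [ut dt ->]] := decE hd.
have ust : uniq (undup (s ++ t)) by apply: undup_uniq.
rewrite (@sum_widen c s _ us ust) //; last first.
  by move=> g gs; rewrite mem_undup mem_cat gs.
rewrite (@sum_widen d t _ ut ust) //; last first.
  by move=> g gs; rewrite mem_undup mem_cat gs orbT.
rewrite -big_split /=; apply: decI => // g; last exact: subgroupD.
by rewrite mem_undup mem_cat negb_or => /andP[/cs -> /dt ->]; rewrite addr0.
Qed.

Lemma decN W c x : (forall g, is_subgroup (W g)) ->
  decomposition W c x -> decomposition W (fun g => - c g) (- x).
Proof.
move=> hV hc; have [_ Vc _] := hc; have [s [us cs ->]] := decE hc.
rewrite -sumrN; apply: decI => // g; last exact: subgroupN.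
by move=> /cs ->; rewrite oppr0.
Qed.

Lemma dec_single W h x : (forall g, is_subgroup (W g)) -> W h x ->
  decomposition W (fun g => if g == h then x else 0) x.
Proof.
move=> hV Vx.
have e : x = \sum_(g <- [:: h]) (if g == h then x else 0).
  by rewrite big_seq1 eqxx.
rewrite {2}e; apply: decI => // g.
  by rewrite inE => /negbTE ->.
by case: eqP => [->|_] //; case: (hV g).
Qed.

Lemma dec0 W : (forall g, is_subgroup (W g)) -> decomposition W (fun=> 0) 0.
Proof.
move=> hV; have := @decI W (fun=> 0) [::]; rewrite big_nil; apply=> // g.
by case: (hV g).
Qed.

Lemma direct_sumI W : (forall g, is_subgroup (W g)) ->
  (forall x, exists c, decomposition W c x) ->
  (forall c (s : seq G), uniq s -> (forall g, g \notin s -> c g = 0) ->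
     (forall g, W g (c g)) -> \sum_(g <- s) c g = 0 -> forall g, c g = 0) ->
  is_direct_sum W.
Proof.
move=> hV hex hun; split=> // x; have [c hc] := hex x.
exists c; split=> // d hd; apply/funext => g; apply/eqP; rewrite -subr_eq0.
have hcd := decD hV hc (decN hV hd); rewrite subrr in hcd.
have [_ Vcd _] := hcd; have [s [us cs e]] := decE hcd.
by apply/eqP; apply: (hun _ s us cs Vcd (esym e)).
Qed.

Lemma direct_sum_pr W (p : G -> V -> V) :
  (forall g, is_subgroup (W g)) ->
  (forall x, exists c, decomposition W c x) ->
  (forall g x y, p g (x + y) = p g x + p g y) ->
  (forall g x, W g x -> p g x = x) ->
  (forall g h x, W h x -> g <> h -> p g x = 0) -> is_direct_sum W.
Proof.
move=> hV hex pD p1 p0; apply: direct_sumI => // c s us cs Vc sc g.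
have p00 : p g 0 = 0.
  by apply: (addrI (p g 0)); rewrite -pD !addr0.
have pS (t : seq G) : p g (\sum_(h <- t) c h) = \sum_(h <- t) p g (c h).
  elim: t => [|h t ih]; first by rewrite !big_nil p00.
  by rewrite !big_cons pD ih.
have := pS s; rewrite sc p00.
case gs : (g \in s); last by rewrite cs // gs.
rewrite (bigD1_seq g) //= p1 // big1 ?addr0 // => h hg.
by apply: (p0 _ h) => //; apply/eqP; rewrite eq_sym.
Qed.

End DirectSum.

Section Projections.
Variables (G : choiceType) (V : zmodType) (W : G -> set V).
Hypothesis hV : is_direct_sum W.

(* The component of degree g. *)
Definition hpr (g : G) (x : V) : V := projT1 (cid (hV.2 x)) g.

Lemma hpr_dec x : decomposition W (hpr^~ x) x.
Proof. by rewrite /hpr; case: cid => c [/= hc _]. Qed.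

Lemma hpr_uniq x c : decomposition W c x -> forall g, hpr g x = c g.
Proof. by move=> hc g; rewrite /hpr; case: cid => d [/= _ /(_ c hc) ->]. Qed.

Lemma hprD g x y : hpr g (x + y) = hpr g x + hpr g y.
Proof.
by apply: (hpr_uniq (c := fun g => hpr g x + hpr g y));
   apply: decD (hpr_dec x) (hpr_dec y); apply: hV.1.
Qed.

Lemma hpr_mem g x : W g (hpr g x).
Proof. by case: (hpr_dec x). Qed.

Lemma hpr_hom h x g : W h x -> hpr g x = if g == h then x else 0.
Proof.
by move=> hx; rewrite (hpr_uniq (dec_single hV.1 hx)).
Qed.

Lemma hom_ind (P : V -> Prop) : P 0 -> (forall x y, P x -> P y -> P (x + y)) ->
  (forall g x, W g x -> P x) -> forall x, P x.
Proof.
move=> P0 PD Ph x; have [s [_ _ ->]] := decE (hpr_dec x).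
elim: s => [|g s ih]; first by rewrite big_nil.
by rewrite big_cons; apply: PD => //; apply: (Ph g); apply: hpr_mem.
Qed.

End Projections.

(* Gradings are internal. The condition 1 \in R_0 follows from the others. *)
Record gring (G : zmodType) : Type := GRingPack {
  gring_car :> comPzRingType;
  gring_part : G -> set gring_car;
  gring_sum : is_direct_sum gring_part;
  gring_mul : forall g h a b,
    gring_part g a -> gring_part h b -> gring_part (g + h) (a * b)
}.

Record gmod (G : zmodType) (R : gring G) : Type := GModPack {
  gmod_car :> lmodType R;
  gmod_part : G -> set gmod_car;
  gmod_sum : is_direct_sum gmod_part;
  gmod_scale : forall g h a x,
    gring_part g a -> gmod_part h x -> gmod_part (g + h) (a *: x)
}.
Arguments gmod_part {G R} M _ _ : rename.

Section Graded.
Variables (G : zmodType) (R : gring G).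
Implicit Types M N P : gmod R.

Lemma part_sub M g : is_subgroup (gmod_part M g).
Proof. exact: (gmod_sum M).1. Qed.

Definition is_gmor M N (f : M -> N) : Prop :=
  linear f /\ forall g x, gmod_part M g x -> gmod_part N g (f x).

Definition is_gmorb M N : {pred M -> N} := fun f => `[< is_gmor f >].

Record gmor M N :=
  GMor { gmor_fun :> M -> N; _ : gmor_fun \in @is_gmorb M N }.

HB.instance Definition _ M N := [isSub for @gmor_fun M N].
HB.instance Definition _ M N := [Choice of gmor M N by <:].

Lemma gmorP M N (f : gmor M N) : is_gmor f.
Proof. by case: f => f /= /asboolP. Qed.

Lemma gmor_eq M N (f f' : gmor M N) : f =1 f' -> f = f'.
Proof. by move=> e; apply: val_inj; apply/funext. Qed.

Lemma linearfB M N (f : M -> N) : linear f -> forall x y, f (x - y) = f x - f y.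
Proof.
by move=> lf x y; rewrite addrC -scaleN1r lf scaleN1r addrC.
Qed.

Lemma is_gmor0 M N : is_gmor (fun _ : M => 0 : N).
Proof.
split; first by move=> a x y; rewrite scaler0 addr0.
by move=> g x _; case: (part_sub N g).
Qed.

Lemma is_gmorB M N (f f' : M -> N) :
  is_gmor f -> is_gmor f' -> is_gmor (fun x => f x - f' x).
Proof.
move=> [lf hf] [lf' hf']; split.
  by move=> a x y; rewrite lf lf' scalerBr addrACA opprD.
by move=> g x Mx; apply: (part_sub N g).2; [apply: hf | apply: hf'].
Qed.

Lemma gmor_closed M N : zmod_closed (@is_gmorb M N).
Proof.
split; first by rewrite unfold_in; apply/asboolP; apply: is_gmor0.
move=> f f'; rewrite !unfold_in => /asboolP hf /asboolP hf'; apply/asboolP.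
exact: is_gmorB.
Qed.

HB.instance Definition _ M N :=
  GRing.isZmodClosed.Build (M -> N) (@is_gmorb M N) (@gmor_closed M N).
HB.instance Definition _ M N :=
  [SubChoice_isSubZmodule of gmor M N by <:].

Fact is_gmor_comp M N P (f : gmor N P) (f' : gmor M N) : is_gmor (f \o f').
Proof.
have [lf hf] := gmorP f; have [lf' hf'] := gmorP f'; split.
  by move=> a x y /=; rewrite lf' lf.
by move=> g x Mx /=; apply: hf; apply: hf'.
Qed.

Definition gcomp M N P (f : gmor N P) (f' : gmor M N) : gmor M P :=
  GMor (asboolT (is_gmor_comp f f')).

Fact is_gmor_id M : is_gmor (@id M).
Proof. by split. Qed.

Definition gid M : gmor M M := GMor (asboolT (is_gmor_id M)).

Definition is_mono M N (f : gmor M N) : Prop :=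
  forall P (u v : gmor P M), gcomp f u = gcomp f v -> u = v.

Definition is_epi M N (f : gmor M N) : Prop :=
  forall P (u v : gmor N P), gcomp u f = gcomp v f -> u = v.

Definition is_iso M N (f : gmor M N) : Prop :=
  exists f' : gmor N M, gcomp f' f = gid M /\ gcomp f f' = gid N.

Definition short_exact (A B C : zmodType) (f : A -> B) (f' : B -> C) : Prop :=
  [/\ injective f, range f = f' @^-1` [set 0] & range f' = [set: C]].

(* Hom_{Mod^G(R)}(P, _) is exact. Exactness is tested on elements, as kernels
   and images in Mod^G(R) are those of the underlying maps. *)
Definition is_projective P : Prop :=
  forall M N Q (f : gmor M N) (f' : gmor N Q), short_exact f f' ->
    short_exact (gcomp f : gmor P M -> gmor P N)
                (gcomp f' : gmor P N -> gmor P Q).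

(* The shift M(g), with M(g)_h = M_(g + h). *)
Section Shift.
Variables (M : gmod R) (g : G).

Definition shift_part (h : G) : set M := gmod_part M (g + h).

Fact shift_sum : is_direct_sum shift_part.
Proof.
have hs h : is_subgroup (shift_part h) by apply: part_sub.
apply: (direct_sum_pr (p := fun h => hpr (gmod_sum M) (g + h))) => //.
- move=> x; have hd := hpr_dec (gmod_sum M) x.
  exists (fun h => hpr (gmod_sum M) (g + h) x).
  have [s [us cs {2}->]] := decE hd.
  have -> : \sum_(k <- s) hpr (gmod_sum M) k x =
      \sum_(h <- [seq k - g | k <- s]) hpr (gmod_sum M) (g + h) x.
    by rewrite big_map; apply: eq_bigr => k _; rewrite addrC subrK.
  apply: decI => [|h hh|h]; last exact: hpr_mem.
    by rewrite map_inj_uniq //; apply: addIr.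
  apply: cs; apply: contra hh => hh; apply/mapP; exists (g + h) => //.
  by rewrite addrC addKr.
- by move=> h x y; apply: hprD.
- by move=> h x hx; rewrite (hpr_hom (gmod_sum M) _ hx) eqxx.
- move=> h k x hx hk; rewrite (hpr_hom (gmod_sum M) _ hx); case: eqP => // e.
  by case: hk; apply: (addrI g).
Qed.

Fact shift_scale h k a x :
  gring_part h a -> shift_part k x -> shift_part (h + k) (a *: x).
Proof. by rewrite /shift_part addrCA; apply: gmod_scale. Qed.

Definition shift : gmod R := GModPack shift_sum shift_scale.

End Shift.

Definition gregular : gmod R :=
  @GModPack G R (gring_car R)^o (@gring_part G R) (gring_sum R)
    (@gring_mul G R).

(* The finite direct sum of the R(g i), with componentwise degrees. *)
Section Free.
Variables (I : finType) (g : I -> G).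

Definition gfree_car : lmodType R := {ffun I -> (gring_car R)^o}.

Definition gfree_part (h : G) : set gfree_car :=
  [set x | forall i, gmod_part (shift gregular (g i)) h (x i)].

Fact gfree_sum : is_direct_sum gfree_part.
Proof.
have hs h : is_subgroup (gfree_part h).
  split=> [i|x y hx hy i]; first by rewrite ffunE; case: (part_sub (shift gregular (g i)) h).
  by rewrite !ffunE; apply: (part_sub (shift gregular (g i)) h).2.
apply: (direct_sum_pr (p := fun h (x : gfree_car) =>
  [ffun i => hpr (gmod_sum (shift gregular (g i))) h (x i)] : gfree_car)) => //.
- move=> x.
  pose e (i : I) (a : (gring_car R)^o) : gfree_car :=
    [ffun j => if j == i then a else 0].
  have eD i a b : e i (a + b) = e i a + e i b.
    by apply/ffunP => j; rewrite !ffunE; case: eqP; rewrite ?addr0.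
  have -> : x = \sum_i e i (x i).
    apply/ffunP => j; rewrite sum_ffunE (bigD1 j) //= big1 => [|i ij].
      by rewrite ffunE eqxx addr0.
    by rewrite ffunE eq_sym (negbTE ij).
  apply: (big_ind (fun y => exists c, decomposition gfree_part c y)).
  + by exists (fun=> 0); apply: dec0.
  + by move=> y z [c hc] [d hd]; exists (fun h => c h + d h); apply: decD.
  move=> i _; move: (x i).
  apply: (hom_ind (gmod_sum (shift gregular (g i)))).
  + exists (fun=> 0); have -> : e i 0 = 0.
      by apply/ffunP => j; rewrite !ffunE; case: eqP.
    exact: dec0.
  + move=> a b [c hc] [d hd]; rewrite eD.
    by exists (fun h => c h + d h); apply: decD.
  + move=> h a ha; eexists; apply: (dec_single (h := h)) => //.
    move=> j; rewrite ffunE; case: eqP => [->|_] //.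
    by case: (part_sub (shift gregular (g j)) h).
- by move=> h x y; apply/ffunP => i; rewrite !ffunE; apply: hprD.
- move=> h x hx; apply/ffunP => i; rewrite !ffunE.
  by rewrite (hpr_hom (gmod_sum (shift gregular (g i))) _ (hx i)) eqxx.
- move=> h k x hx hk; apply/ffunP => i; rewrite !ffunE.
  by rewrite (hpr_hom (gmod_sum (shift gregular (g i))) _ (hx i)); case: eqP.
Qed.

Fact gfree_scale h k a x :
  gring_part h a -> gfree_part k x -> gfree_part (h + k) (a *: x).
Proof. by move=> ha hx i; rewrite ffunE; apply: gmod_scale. Qed.

Definition gfree : gmod R := GModPack gfree_sum gfree_scale.

End Free.

Definition is_finite_type M : Prop :=
  exists (I : finType) (g : I -> G) (F : gmod R),
    (exists i : gmor F (gfree g), is_iso i) /\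
    (exists p : gmor F M, is_epi p).

End Graded.

(* The tensor product over R as the quotient of the free commutative monoid on M x N (finite
   formal sums, written as sequences) by the congruence generated by the
   bilinearity relations; the quotient is already a group. *)
Section Tensor.
Variables (G : zmodType) (R : gring G) (M N : gmod R).

Inductive tens_rel : seq (M * N) -> seq (M * N) -> Prop :=
| tens_refl s : tens_rel s s
| tens_sym s t : tens_rel s t -> tens_rel t s
| tens_trans t s u : tens_rel s t -> tens_rel t u -> tens_rel s u
| tens_cat s t s' t' :
    tens_rel s t -> tens_rel s' t' -> tens_rel (s ++ s') (t ++ t')
| tens_comm s t : tens_rel (s ++ t) (t ++ s)
| tens_zero y : tens_rel [:: (0, y)] [::]
| tens_addl x x' y : tens_rel [:: (x + x', y)] [:: (x, y); (x', y)]
| tens_addr x y y' : tens_rel [:: (x, y + y')] [:: (x, y); (x, y')]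
| tens_scale a x y : tens_rel [:: (a *: x, y)] [:: (x, a *: y)].

Definition tens_relb (s t : seq (M * N)) : bool := `[< tens_rel s t >].

Fact tens_relb_refl : reflexive tens_relb.
Proof. by move=> s; apply/asboolP/tens_refl. Qed.

Fact tens_relb_sym : symmetric tens_relb.
Proof. by move=> s t; apply/asboolP/asboolP; apply: tens_sym. Qed.

Fact tens_relb_trans : transitive tens_relb.
Proof.
by move=> t s u /asboolP h /asboolP h'; apply/asboolP; apply: tens_trans h h'.
Qed.

Canonical tens_equiv :=
  EquivRel tens_relb tens_relb_refl tens_relb_sym tens_relb_trans.

Definition tens_car : Type := {eq_quot tens_equiv}.
HB.instance Definition _ := EqQuotient.on tens_car.
HB.instance Definition _ := Choice.on tens_car.

Definition tens_of (s : seq (M * N)) : tens_car := \pi_tens_car s.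

Lemma tens_ofP s t : tens_rel s t <-> tens_of s = tens_of t.
Proof.
split=> [h|]; first by apply/eqmodP/asboolP.
by move/eqmodP/asboolP.
Qed.

Lemma tens_ind (P : tens_car -> Prop) :
  (forall s, P (tens_of s)) -> forall t, P t.
Proof. by move=> h t; rewrite -[t]reprK; apply: h. Qed.

Lemma tens_reprP s : tens_rel (repr (tens_of s)) s.
Proof. by apply/tens_ofP; rewrite /tens_of reprK. Qed.

Definition tadd (t u : tens_car) : tens_car := tens_of (repr t ++ repr u).
Definition tscale_seq (a : R) (s : seq (M * N)) : seq (M * N) :=
  [seq (a *: p.1, p.2) | p <- s].
Definition tscale (a : R) (t : tens_car) : tens_car :=
  tens_of (tscale_seq a (repr t)).

Lemma taddE s t : tadd (tens_of s) (tens_of t) = tens_of (s ++ t).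
Proof. by apply/tens_ofP; apply: tens_cat; apply: tens_reprP. Qed.

Lemma tscale_rel a s t : tens_rel s t -> tens_rel (tscale_seq a s) (tscale_seq a t).
Proof.
elim=> {s t} [s|s t _ h|t s u _ h _ h'|s t s' t' _ h _ h'|s t|y|x x' y|x y y'|b x y].
- exact: tens_refl.
- exact: tens_sym.
- exact: tens_trans h h'.
- by rewrite /tscale_seq !map_cat; apply: tens_cat.
- by rewrite /tscale_seq !map_cat; apply: tens_comm.
- by rewrite /= scaler0; apply: tens_zero.
- by rewrite /= scalerDr; apply: tens_addl.
- exact: tens_addr.
- by rewrite /= scalerA mulrC -scalerA; apply: tens_scale.
Qed.

Lemma tscaleE a s : tscale a (tens_of s) = tens_of (tscale_seq a s).
Proof. by apply/tens_ofP/tscale_rel/tens_reprP. Qed.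

Fact taddA : associative tadd.
Proof.
by elim/tens_ind=> s; elim/tens_ind=> t; elim/tens_ind=> u; rewrite !taddE catA.
Qed.

Fact taddC : commutative tadd.
Proof.
elim/tens_ind=> s; elim/tens_ind=> t; rewrite !taddE.
exact/tens_ofP/tens_comm.
Qed.

Fact tadd0 : left_id (tens_of [::]) tadd.
Proof. by elim/tens_ind=> s; rewrite taddE. Qed.

Lemma tscale_cons a p s :
  tens_of (tscale_seq a (p :: s)) =
  tadd (tens_of [:: (a *: p.1, p.2)]) (tens_of (tscale_seq a s)).
Proof. by rewrite taddE. Qed.

Lemma tens_cons p s : tens_of (p :: s) = tadd (tens_of [:: p]) (tens_of s).
Proof. by rewrite taddE. Qed.

Fact tscaleDl t a b : tscale (a + b) t = tadd (tscale a t) (tscale b t).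
Proof.
elim/tens_ind: t => s; rewrite !tscaleE.
elim: s => [|p s ih]; first by rewrite taddE.
rewrite !tscale_cons ih scalerDl.
have -> : tens_of [:: (a *: p.1 + b *: p.1, p.2)] =
   tadd (tens_of [:: (a *: p.1, p.2)]) (tens_of [:: (b *: p.1, p.2)]).
  by rewrite taddE; apply/tens_ofP/tens_addl.
by rewrite -!taddA; congr tadd; rewrite !taddA; congr tadd; apply: taddC.
Qed.

Fact tscale0 t : tscale 0 t = tens_of [::].
Proof.
elim/tens_ind: t => s; rewrite tscaleE.
elim: s => [|p s ih] //; rewrite tscale_cons ih scale0r.
have -> : tens_of [:: (0, p.2)] = tens_of [::] by apply/tens_ofP/tens_zero.
by rewrite tadd0.
Qed.

Fact tscale1 : left_id 1 tscale.
Proof.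
elim/tens_ind=> s; rewrite tscaleE; congr tens_of.
by rewrite -[RHS]map_id; apply: eq_map => -[x y]; rewrite scale1r.
Qed.

Fact taddN : left_inverse (tens_of [::]) (tscale (-1)) tadd.
Proof.
by move=> t; rewrite -{2}[t]tscale1 -tscaleDl addNr tscale0.
Qed.

HB.instance Definition _ := GRing.isZmodule.Build tens_car taddA taddC tadd0 taddN.

Fact tscaleA a b t : tscale a (tscale b t) = tscale (a * b) t.
Proof.
elim/tens_ind: t => s; rewrite !tscaleE; congr tens_of.
by rewrite /tscale_seq -map_comp; apply: eq_map => p /=; rewrite scalerA.
Qed.

Fact tscaleDr : right_distributive tscale +%R.
Proof.
move=> a; elim/tens_ind=> s; elim/tens_ind=> t.
by rewrite /GRing.add /= !(taddE, tscaleE) /tscale_seq map_cat.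
Qed.

Fact tscaleDl' t : {morph tscale^~ t : a b / a + b}.
Proof. by move=> a b; apply: tscaleDl. Qed.

HB.instance Definition _ := GRing.Zmodule_isLmodule.Build (gring_car R) tens_car
  tscaleA tscale1 tscaleDr tscaleDl'.

Definition pure (x : M) (y : N) : tens_car := tens_of [:: (x, y)].

Lemma tens_of_sum s : tens_of s = \sum_(p <- s) pure p.1 p.2.
Proof.
elim: s => [|[x y] s ih]; first by rewrite big_nil.
by rewrite big_cons -ih tens_cons.
Qed.

Lemma pureDl x x' y : pure (x + x') y = pure x y + pure x' y.
Proof.
by rewrite /pure /GRing.add /= taddE; apply/tens_ofP/tens_addl.
Qed.

Lemma pureDr x y y' : pure x (y + y') = pure x y + pure x y'.
Proof.
by rewrite /pure /GRing.add /= taddE; apply/tens_ofP/tens_addr.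
Qed.

Lemma pureZl a x y : pure (a *: x) y = a *: pure x y.
Proof. by rewrite /pure /GRing.scale /= tscaleE. Qed.

Lemma pureZr a x y : pure x (a *: y) = a *: pure x y.
Proof. by rewrite -pureZl; apply/esym/tens_ofP/tens_scale. Qed.

Lemma pure0l y : pure 0 y = 0.
Proof. exact/tens_ofP/tens_zero. Qed.

Lemma pure0r x : pure x 0 = 0.
Proof. by rewrite -(scale0r (0 : N)) pureZr scale0r. Qed.

Lemma pureNl x y : pure (- x) y = - pure x y.
Proof. by rewrite -scaleN1r pureZl scaleN1r. Qed.

Lemma tens_pure_ind (P : tens_car -> Prop) : P 0 ->
  (forall t u, P t -> P u -> P (t + u)) -> (forall x y, P (pure x y)) ->
  forall t, P t.
Proof.
move=> P0 PD Pp; elim/tens_ind=> s; rewrite tens_of_sum.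
by apply: (big_ind P) => // p _; apply: Pp.
Qed.

Section Lift.
Variables (V : zmodType) (b : M -> N -> V).

Definition balanced : Prop :=
  [/\ forall x x' y, b (x + x') y = b x y + b x' y,
      forall x y y', b x (y + y') = b x y + b x y'
    & forall a x y, b (a *: x) y = b x (a *: y)].

Definition tlift (t : tens_car) : V := \sum_(p <- repr t) b p.1 p.2.

Hypothesis hb : balanced.

Lemma tlift_rel s t : tens_rel s t ->
  \sum_(p <- s) b p.1 p.2 = \sum_(p <- t) b p.1 p.2.
Proof.
have [bDl bDr bZ] := hb.
elim=> {s t} [s|s t _ h|t s u _ h _ h'|s t s' t' _ h _ h'|s t|y|x x' y|x y y'|a x y].
- by [].
- by rewrite h.
- by rewrite h.
- by rewrite !big_cat /= h h'.
- by rewrite !big_cat /= addrC.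
- rewrite big_seq1 big_nil /=; apply: (addrI (b 0 y)).
  by rewrite -bDl !addr0.
- by rewrite big_seq1 big_cons big_seq1 /= bDl.
- by rewrite big_seq1 big_cons big_seq1 /= bDr.
- by rewrite !big_seq1 /= bZ.
Qed.

Lemma tliftE s : tlift (tens_of s) = \sum_(p <- s) b p.1 p.2.
Proof. exact/tlift_rel/tens_reprP. Qed.

Lemma tlift_pure x y : tlift (pure x y) = b x y.
Proof. by rewrite tliftE big_seq1. Qed.

Lemma tliftD t u : tlift (t + u) = tlift t + tlift u.
Proof.
elim/tens_ind: t => s; elim/tens_ind: u => t.
by rewrite /GRing.add /= taddE !tliftE big_cat.
Qed.

Lemma tlift0 : tlift 0 = 0.
Proof. by rewrite tliftE big_nil. Qed.

End Lift.

Definition tens_part (g : G) : set tens_car :=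
  [set t | exists s : seq (M * N),
    (forall p, p \in s -> exists h k,
      [/\ gmod_part M h p.1, gmod_part N k p.2 & h + k = g]) /\
    t = \sum_(p <- s) pure p.1 p.2].

Lemma pure_part g h x y :
  gmod_part M g x -> gmod_part N h y -> tens_part (g + h) (pure x y).
Proof.
move=> hx hy; exists [:: (x, y)]; split; last by rewrite big_seq1.
by move=> p; rewrite inE => /eqP ->; exists g, h.
Qed.

Fact tens_part_sub g : is_subgroup (tens_part g).
Proof.
split; first by exists [::]; rewrite big_nil.
move=> t u [s [hs ->]] [s' [hs' ->]].
exists (s ++ [seq (- p.1, p.2) | p <- s']); split.
  move=> p; rewrite mem_cat => /orP[/hs //|/mapP[q /hs' [h [k [hh hk e]]] ->]].
  by exists h, k; split=> //; apply: subgroupN => //; apply: part_sub.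
rewrite big_cat big_map -sumrN /=; congr (_ + _).
by apply: eq_bigr => p _; rewrite pureNl.
Qed.

Lemma tens_hom_ind (P : tens_car -> Prop) : P 0 ->
  (forall t u, P t -> P u -> P (t + u)) ->
  (forall g h x y, gmod_part M g x -> gmod_part N h y -> P (pure x y)) ->
  forall t, P t.
Proof.
move=> P0 PD Pp; apply: tens_pure_ind => // x y; move: x.
apply: (hom_ind (gmod_sum M)) => [|x x' h h'|g x hx].
- by rewrite pure0l.
- by rewrite pureDl; apply: PD.
move: y; apply: (hom_ind (gmod_sum N)) => [|y y' h h'|h y hy].
- by rewrite pure0r.
- by rewrite pureDr; apply: PD.
exact: Pp hx hy.
Qed.

Section TensProj.
Variable g : G.

Definition tpr (x : M) (y : N) : tens_car :=
  \sum_(h \in [set: G]) pure (hpr (gmod_sum M) h x) (hpr (gmod_sum N) (g - h) y).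

Lemma tpr_seq x y (s : seq G) : uniq s ->
  (forall h, h \notin s -> hpr (gmod_sum M) h x = 0) ->
  tpr x y = \sum_(h <- s) pure (hpr (gmod_sum M) h x) (hpr (gmod_sum N) (g - h) y).
Proof. by move=> us hs; apply: fsum_seq => // h /hs ->; apply: pure0l. Qed.

Lemma tpr_hom h k x y : gmod_part M h x -> gmod_part N k y ->
  tpr x y = if h + k == g then pure x y else 0.
Proof.
move=> hx hy; rewrite (@tpr_seq x y [:: h]) //.
  rewrite big_seq1 (hpr_hom (gmod_sum M) _ hx) (hpr_hom (gmod_sum N) _ hy) eqxx.
  by rewrite subr_eq [k + h]addrC eq_sym; case: eqP => // _; rewrite pure0r.
by move=> l; rewrite inE (hpr_hom (gmod_sum M) _ hx) => /negbTE ->.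
Qed.

Lemma tprDl x x' y : tpr (x + x') y = tpr x y + tpr x' y.
Proof.
have [s [us cs _]] := decE (hpr_dec (gmod_sum M) x).
have [t [ut ct _]] := decE (hpr_dec (gmod_sum M) x').
have ust : uniq (undup (s ++ t)) by apply: undup_uniq.
have cu h : h \notin undup (s ++ t) -> hpr (gmod_sum M) h x = 0.
  by rewrite mem_undup mem_cat negb_or => /andP[/cs].
have du h : h \notin undup (s ++ t) -> hpr (gmod_sum M) h x' = 0.
  by rewrite mem_undup mem_cat negb_or => /andP[_ /ct].
rewrite (tpr_seq y ust cu) (tpr_seq y ust du) (@tpr_seq (x + x') y _ ust).
  by rewrite -big_split /=; apply: eq_bigr => h _; rewrite hprD pureDl.
by move=> h hh; rewrite hprD cu // du // addr0.
Qed.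

Lemma tprDr x y y' : tpr x (y + y') = tpr x y + tpr x y'.
Proof.
have [s [us cs _]] := decE (hpr_dec (gmod_sum M) x).
rewrite !(@tpr_seq x _ s us cs) -big_split /=.
by apply: eq_bigr => h _; rewrite hprD pureDr.
Qed.

Lemma tpr0l y : tpr 0 y = 0.
Proof. by apply: (addrI (tpr 0 y)); rewrite -tprDl !addr0. Qed.

Lemma tpr0r x : tpr x 0 = 0.
Proof. by apply: (addrI (tpr x 0)); rewrite -tprDr !addr0. Qed.

Lemma tpr_balanced : balanced tpr.
Proof.
split=> [x x' y|x y y'|a x y]; [exact: tprDl|exact: tprDr|].
move: a; apply: (hom_ind (gring_sum R)) => [|a b ha hb|l a ha].
- by rewrite !scale0r tpr0l tpr0r.
- by rewrite !scalerDl tprDl tprDr ha hb.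
move: x; apply: (hom_ind (gmod_sum M)) => [|x x' hx hx'|h x hx].
- by rewrite scaler0 !tpr0l.
- by rewrite scalerDr !tprDl hx hx'.
move: y; apply: (hom_ind (gmod_sum N)) => [|y y' hy hy'|k y hy].
- by rewrite scaler0 !tpr0r.
- by rewrite scalerDr !tprDr hy hy'.
rewrite (tpr_hom (gmod_scale ha hx) hy) (tpr_hom hx (gmod_scale ha hy)).
by rewrite pureZl pureZr addrCA addrA.
Qed.

End TensProj.

Fact tens_sum : is_direct_sum tens_part.
Proof.
apply: (direct_sum_pr (p := fun g => tlift (tpr g))).
- exact: tens_part_sub.
- apply: tens_hom_ind.
  + by exists (fun=> 0); apply/dec0/tens_part_sub.
  + move=> t u [c hc] [d hd]; exists (fun h => c h + d h).
    by apply: decD => //; apply: tens_part_sub.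
  + move=> g h x y hx hy; eexists; apply: (dec_single (h := g + h)).
      exact: tens_part_sub.
    exact: pure_part.
- by move=> g t u; apply/tliftD/tpr_balanced.
- move=> g t [s [hs ->]]; elim: s hs => [|p s ih] hs.
    by rewrite big_nil (tlift0 (tpr_balanced g)).
  rewrite big_cons (tliftD (tpr_balanced g)) ih => [|q qs]; last first.
    by apply: hs; rewrite inE qs orbT.
  have [h [k [hh hk e]]] := hs p (mem_head _ _).
  by rewrite (tlift_pure (tpr_balanced g)) (tpr_hom g hh hk) e eqxx.
- move=> g l t [s [hs ->]] gl; elim: s hs => [|p s ih] hs.
    by rewrite big_nil (tlift0 (tpr_balanced g)).
  rewrite big_cons (tliftD (tpr_balanced g)) ih => [|q qs]; last first.
    by apply: hs; rewrite inE qs orbT.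
  have [h [k [hh hk e]]] := hs p (mem_head _ _).
  rewrite (tlift_pure (tpr_balanced g)) (tpr_hom g hh hk) e addr0.
  by case: eqP => // e'; case: gl.
Qed.

Fact tens_partZ g h a t :
  gring_part g a -> tens_part h t -> tens_part (g + h) (a *: t).
Proof.
move=> ha [s [hs ->]]; exists (tscale_seq a s); split.
  move=> _ /mapP[p /hs [k [l [hk hl e]]] ->]; exists (g + k), l.
  by split=> //; [apply: gmod_scale | rewrite -addrA e].
by rewrite scaler_sumr big_map; apply: eq_bigr => p _; rewrite pureZl.
Qed.

Definition gtensor : gmod R := GModPack tens_sum tens_partZ.

End Tensor.

(* The direct sum of the groups Hom_{Mod^G(R)}(M, N(g)) is realized inside the
   module of all maps M -> N, in which their sum is direct (ghom_sum): an element
   is a map that is a finite sum of morphisms M -> N(g), so that it can be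
   evaluated at any element of M. *)
Section GHom.
Variables (G : zmodType) (R : gring G) (M N : gmod R).

(* N and N(g) have the same carrier. *)
Definition is_homog (g : G) : set (M -> N) := [set f | is_gmor (N := shift N g) f].

Definition is_ghom : {pred M -> N} :=
  fun f => `[< exists c, decomposition is_homog c f >].

Lemma homog_sub g : is_subgroup (is_homog g).
Proof.
split; first exact: (is_gmor0 M (shift N g)).
by move=> f f'; apply: (@is_gmorB _ _ M (shift N g)).
Qed.

Lemma homogZ g h a f :
  gring_part g a -> is_homog h f -> is_homog (g + h) (a *: f).
Proof.
move=> ha [lf hf]; split.
  move=> b x y; change (a *: f (b *: x + y) = b *: (a *: f x) + a *: f y).
  by rewrite lf scalerDr !scalerA [a * b]mulrC.
move=> k x hx /=; rewrite /shift_part -addrA.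
exact: (@gmod_scale G R N _ _ _ _ ha (hf _ _ hx)).
Qed.

Fact ghom_closed : subsemimod_closed is_ghom.
Proof.
have h0 : 0 \in is_ghom.
  by apply/asboolP; exists (fun=> 0); apply/dec0/homog_sub.
have hD f f' : f \in is_ghom -> f' \in is_ghom -> f + f' \in is_ghom.
  move=> /asboolP[c hc] /asboolP[d hd]; apply/asboolP.
  by exists (fun g => c g + d g); apply: decD => //; apply: homog_sub.
have hS (I : Type) (s : seq I) (F : I -> M -> N) :
    (forall i, F i \in is_ghom) -> \sum_(i <- s) F i \in is_ghom.
  by move=> hF; apply: (big_ind (fun f => f \in is_ghom)).
split=> // a f /asboolP[c hc].
have [s [_ _ ->]] := decE hc; have [_ hom_c _] := hc.
rewrite scaler_sumr; apply: hS => g; move: a.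
apply: (hom_ind (gring_sum R)) => [|a b ha hb|h a ha].
- by rewrite scale0r.
- by rewrite scalerDl; apply: hD.
apply/asboolP; eexists; apply: (dec_single homog_sub (h := h + g)).
exact: homogZ.
Qed.

HB.instance Definition _ :=
  GRing.isSubmodClosed.Build (gring_car R) (M -> N) is_ghom ghom_closed.

Record ghom_car := GHom { ghom_fun :> M -> N; _ : ghom_fun \in is_ghom }.

HB.instance Definition _ := [isSub for ghom_fun].
HB.instance Definition _ := [Choice of ghom_car by <:].
HB.instance Definition _ := [SubChoice_isSubLmodule of ghom_car by <:].

Definition ghom_part (g : G) : set ghom_car := [set f | is_homog g f].

Lemma is_ghom_homog g f : is_homog g f -> f \in is_ghom.
Proof.
by move=> hf; apply/asboolP; eexists; apply: (dec_single homog_sub hf).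
Qed.

Lemma ghom_sumE (I : Type) (s : seq I) (F : I -> ghom_car) x :
  (\sum_(i <- s) F i) x = \sum_(i <- s) F i x.
Proof.
elim: s => [|i s ih]; first by rewrite !big_nil.
by rewrite !big_cons -ih.
Qed.

Lemma ghom_eq (u v : ghom_car) : u =1 v -> u = v.
Proof. by move=> e; apply: val_inj; apply/funext. Qed.

Lemma ghom_part_sub g : is_subgroup (ghom_part g).
Proof.
split; first exact: (homog_sub g).1.
by move=> u v hu hv; apply: (homog_sub g).2.
Qed.

Fact ghom_sum : is_direct_sum ghom_part.
Proof.
apply: direct_sumI.
- exact: ghom_part_sub.
- move=> f; have /asboolP[c hc] := valP f.
  have [s [us cs e]] := decE hc; have [_ hom_c _] := hc.
  pose d g := GHom (is_ghom_homog (hom_c g)).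
  have -> : f = \sum_(g <- s) d g.
    apply: ghom_eq => x; rewrite ghom_sumE.
    by have := congr1 (@^~ x) e; rewrite fct_sumE.
  exists d; apply: decI => // g /cs h.
  by apply: ghom_eq => x; rewrite /= h.
move=> c s us cs hc e g; apply: ghom_eq; apply: (hom_ind (gmod_sum M)).
- have [lf _] := hc g; have := linearfB lf 0 0.
  by rewrite !subrr.
- move=> x y hx hy; have [lf _] := hc g.
  by have := lf 1 x y; rewrite !scale1r hx hy addr0.
move=> k x hx.
pose d l := c (l - k) x.
have dd : decomposition (gmod_part N) d (\sum_(l <- [seq h + k | h <- s]) d l).
  apply: decI.
  - by rewrite map_inj_uniq //; apply: addIr.
  - move=> l hl; rewrite /d cs //; apply: contra hl => hl.
    by apply/mapP; exists (l - k); rewrite ?subrK.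
  - move=> l; have [_ hl] := hc (l - k); have := hl _ _ hx.
    by rewrite /= /shift_part subrK.
have := hpr_uniq (gmod_sum N) dd (g + k).
rewrite big_map {2}/d addrK => <-.
under eq_bigr do rewrite /d addrK.
by rewrite -ghom_sumE e (hpr_uniq (gmod_sum N) (dec0 (gmod_sum N).1)).
Qed.

Fact ghom_scale g h a u :
  gring_part g a -> ghom_part h u -> ghom_part (g + h) (a *: u).
Proof. exact: homogZ. Qed.

Definition ghom : gmod R := GModPack ghom_sum ghom_scale.

Lemma ghom_linear (u : ghom) : linear u.
Proof.
have /asboolP[c hc] := valP u; have [s [_ _ e]] := decE hc.
have [_ hom_c _] := hc.
have eu z : u z = \sum_(g <- s) c g z.
  by have := congr1 (@^~ z) e; rewrite fct_sumE.
move=> a x y; rewrite !eu scaler_sumr -big_split /=; apply: eq_bigr => g _.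
by have [lf _] := hom_c g; apply: lf.
Qed.

End GHom.

Section Mu.
Variables (G : zmodType) (R : gring G) (M N : gmod R).

Let Mdual : gmod R := ghom M (gregular R).

Definition mu_fun (x : M) (y : N) : Mdual -> N := fun u => (u x : R) *: y.

Lemma dualD (u : Mdual) x x' : u (x + x') = u x + u x'.
Proof. by have := ghom_linear u 1 x x'; rewrite !scale1r. Qed.

Lemma dualZ (u : Mdual) a x : u (a *: x) = a * (u x : R).
Proof.
have u0 : u 0 = 0 by apply: (addrI (u 0)); rewrite -dualD !addr0.
by have := ghom_linear u a x 0; rewrite u0 !addr0.
Qed.

Lemma mu_homog g h x y : gmod_part M g x -> gmod_part N h y ->
  is_homog (g + h) (mu_fun x y).
Proof.
move=> hx hy; split.
  move=> a u v.
  change ((a * (u x : R) + v x) *: y = a *: ((u x : R) *: y) + (v x : R) *: y).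
  by rewrite scalerDl scalerA.
move=> k u [_ hu]; rewrite /= /shift_part /mu_fun addrC addrA.
by apply: gmod_scale => //; apply: (hu _ _ hx).
Qed.

Fact mu_fun_ghom x y : mu_fun x y \in is_ghom (M := Mdual) (N := N).
Proof.
have D (f f' : Mdual -> N) : f \in is_ghom (M := Mdual) (N := N) ->
    f' \in is_ghom (M := Mdual) (N := N) ->
    f + f' \in is_ghom (M := Mdual) (N := N) by apply: rpredD.
have Z : (0 : Mdual -> N) \in is_ghom (M := Mdual) (N := N) by apply: rpred0.
move: x; apply: (hom_ind (gmod_sum M)) => [|x x' hx hx'|g x hx].
- suff -> : mu_fun 0 y = 0 by [].
  by apply/funext => u; rewrite /mu_fun -(scale0r (0 : M)) dualZ mul0r scale0r.
- suff -> : mu_fun (x + x') y = mu_fun x y + mu_fun x' y by apply: D.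
  by apply/funext => u; rewrite /mu_fun dualD scalerDl.
move: y; apply: (hom_ind (gmod_sum N)) => [|y y' hy hy'|h y hy].
- suff -> : mu_fun x 0 = 0 by [].
  by apply/funext => u; rewrite /mu_fun scaler0.
- suff -> : mu_fun x (y + y') = mu_fun x y + mu_fun x y' by apply: D.
  by apply/funext => u; rewrite /mu_fun scalerDr.
exact: is_ghom_homog (mu_homog hx hy).
Qed.

Definition mu_elem (x : M) (y : N) : ghom Mdual N := GHom (mu_fun_ghom x y).

Lemma mu_balanced : balanced mu_elem.
Proof.
split=> [x x' y|x y y'|a x y]; apply: ghom_eq => u.
- change ((u (x + x') : R) *: y = (u x : R) *: y + (u x' : R) *: y).
  by rewrite dualD scalerDl.
- exact: scalerDr.
- change ((u (a *: x) : R) *: y = (u x : R) *: (a *: y)).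
  by rewrite dualZ scalerA mulrC.
Qed.

Fact is_gmor_mu : is_gmor (M := gtensor M N) (N := ghom Mdual N) (tlift mu_elem).
Proof.
have D := tliftD mu_balanced; have T0 := tlift0 mu_balanced.
have E := tlift_pure mu_balanced.
split.
  move=> a t u; rewrite [LHS]D; congr (_ + _); move: t.
  apply: tens_pure_ind => [|t t' h h'|x y].
  - by rewrite scaler0 T0 scaler0.
  - by rewrite scalerDr !D h h' scalerDr.
  - rewrite -[X in tlift _ X]pureZr !E; apply: ghom_eq => v.
    change ((v x : R) *: (a *: y) = a *: ((v x : R) *: y)).
    by rewrite !scalerA mulrC.
move=> g t [s [hs ->]]; elim: s hs => [|p s ih] hs.
  by rewrite big_nil T0; apply: (part_sub (ghom Mdual N) g).1.
rewrite big_cons D; apply: subgroupD; first exact: part_sub.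
  rewrite E; have [h [k [hh hk <-]]] := hs p (mem_head _ _).
  exact: mu_homog.
by apply: ih => q qs; apply: hs; rewrite inE qs orbT.
Qed.

(* See mu_pure for the value on x (x) y. *)
Definition mu : gmor (gtensor M N) (ghom (ghom M (gregular R)) N) :=
  GMor (asboolT is_gmor_mu).

Lemma mu_pure (x : M) (y : N) (u : ghom M (gregular R)) :
  mu (pure x y) u = (u x : R) *: y.
Proof. by rewrite /= (tlift_pure mu_balanced). Qed.

End Mu.

(* Main.v *)
(* A projective graded module M is a retract of a free one, hence has a homogeneous
   dual basis: elements e_i and forms f_i such that x is the finite sum of the
   f_i(x) e_i. Then every t in M (x) N is the sum of the e_i (x) mu(t)(f_i), so that
   mu(t) determines t. If the dual basis is finite, the map sending phi to the sum
   of the e_i (x) phi(f_i) is a morphism, and it is inverse to mu because each form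
   u is the sum of the u(e_i) f_i. *)
Require Import Defs.
From HB Require Import structures.
From mathcomp Require Import all_boot all_algebra.
From mathcomp Require Import boolp classical_sets functions fsbigop.

Set Implicit Arguments.
Unset Strict Implicit.
Unset Printing Implicit Defensive.
Import GRing.Theory.
Local Open Scope classical_set_scope.
Local Open Scope ring_scope.
Local Open Scope quotient_scope.

(** * Components in a direct sum *)

Lemma hprB (G : choiceType) (V : zmodType) (W : G -> set V)
    (hV : is_direct_sum W) g x y : hpr hV g (x - y) = hpr hV g x - hpr hV g y.
Proof. by have h := hprD hV g (x - y) y; rewrite subrK in h; rewrite h addrK. Qed.

Lemma hpr0 (G : choiceType) (V : zmodType) (W : G -> set V)
    (hV : is_direct_sum W) g : hpr hV g 0 = 0.
Proof. exact: (hpr_uniq hV (dec0 hV.1)). Qed.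

Lemma setT_subgroup (V : zmodType) : is_subgroup [set: V].
Proof. by []. Qed.

Lemma decomposition_fin_sum (I : finType) (V : zmodType) (c : I -> V) x :
  decomposition (fun=> setT) c x -> x = \sum_i c i.
Proof.
move=> hc; have [s [us cs ->]] := decE hc.
by rewrite (sum_widen us (enum_uniq I)) ?big_enum // => i _; rewrite mem_enum.
Qed.

Section GradedModules.
Variables (G : zmodType) (R : gring G).
Implicit Types M N P : gmod R.

(** * Graded morphisms and homogeneous components *)

Lemma gmorD M N (f : gmor M N) x y : f (x + y) = f x + f y.
Proof. by have [lf _] := gmorP f; have := lf 1 x y; rewrite !scale1r. Qed.

Lemma gmor0 M N (f : gmor M N) : f 0 = 0.
Proof. by apply: (addrI (f 0)); rewrite -gmorD !addr0. Qed.

Lemma gmorB M N (f : gmor M N) x y : f (x - y) = f x - f y.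
Proof. by apply: linearfB; have [] := gmorP f. Qed.

Lemma gmorZ M N (f : gmor M N) a x : f (a *: x) = a *: f x.
Proof.
by have [lf _] := gmorP f; have := lf a x 0; rewrite gmor0 !addr0.
Qed.

Lemma gmor_sum M N (f : gmor M N) (I : Type) (s : seq I) (F : I -> M) :
  f (\sum_(i <- s) F i) = \sum_(i <- s) f (F i).
Proof. exact: (big_morph f (gmorD f) (gmor0 f)). Qed.

(** Applying [f] to the homogeneous decomposition of [x] gives one of [f x], and such a
    decomposition is unique. Kernels and images are graded for this reason. *)
Lemma hpr_gmor M N (f : gmor M N) g x :
  hpr (gmod_sum N) g (f x) = f (hpr (gmod_sum M) g x).
Proof.
apply: (hpr_uniq (gmod_sum N) (c := fun h => f (hpr (gmod_sum M) h x))).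
have [s [us cs e]] := decE (hpr_dec (gmod_sum M) x).
rewrite {2}e gmor_sum; apply: decI => // h; first by move/cs ->; rewrite gmor0.
by apply: (gmorP f).2; apply: hpr_mem.
Qed.

Lemma ghom_lsum M N (u : ghom M N) (J : Type) (s : seq J)
    (a : J -> R) (x : J -> M) :
  u (\sum_(j <- s) a j *: x j) = \sum_(j <- s) a j *: u (x j).
Proof.
have u0 : u 0 = 0 by have := linearfB (ghom_linear u) 0 0; rewrite !subrr.
elim: s => [|j s ih]; first by rewrite !big_nil.
by rewrite !big_cons ghom_linear ih.
Qed.

(** * Graded submodules *)

Record gsubmod M := GSubmod {
  gsubmod_set :> M -> Prop;
  gsubmod0 : gsubmod_set 0;
  gsubmodD : forall x y, gsubmod_set x -> gsubmod_set y -> gsubmod_set (x + y);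
  gsubmodZ : forall a x, gsubmod_set x -> gsubmod_set (a *: x);
  gsubmod_hpr : forall g x, gsubmod_set x -> gsubmod_set (hpr (gmod_sum M) g x)
}.

Definition gsubmod_pred M (S : gsubmod M) : {pred M} := fun x => `[< S x >].

Fact gsubmod_closed M (S : gsubmod M) : subsemimod_closed (gsubmod_pred S).
Proof.
split; first (split; first by apply/asboolP/gsubmod0).
  by move=> x y /asboolP hx /asboolP hy; apply/asboolP/gsubmodD.
by move=> a x /asboolP hx; apply/asboolP/gsubmodZ.
Qed.

HB.instance Definition _ M (S : gsubmod M) :=
  GRing.isSubmodClosed.Build (gring_car R) M (gsubmod_pred S) (gsubmod_closed S).

Section Submodule.
Variables (M : gmod R) (S : gsubmod M).

Record gsub_car := GSub { gsub_val :> M; _ : gsub_val \in gsubmod_pred S }.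

HB.instance Definition _ := [isSub for gsub_val].
HB.instance Definition _ := [Choice of gsub_car by <:].
HB.instance Definition _ := [SubChoice_isSubLmodule of gsub_car by <:].

Definition gsub_part (g : G) : set gsub_car := [set x | gmod_part M g (val x)].

Fact gsub_hpr_subproof g (x : gsub_car) :
  hpr (gmod_sum M) g (val x) \in gsubmod_pred S.
Proof. by have /asboolP hx := valP x; apply/asboolP/gsubmod_hpr. Qed.

Definition gsub_hpr g x := GSub (gsub_hpr_subproof g x).

(** The components of an element of [S] stay in [S], so the projections of [M] restrict to the
    submodule. *)
Fact gsub_sum : is_direct_sum gsub_part.
Proof.
have hs g : is_subgroup (gsub_part g).
  split; first exact: (part_sub M g).1.
  by move=> x y hx hy; apply: (part_sub M g).2.
apply: (direct_sum_pr (p := gsub_hpr)) => //.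
- move=> x; exists (gsub_hpr^~ x).
  have [s [us cs e]] := decE (hpr_dec (gmod_sum M) (val x)).
  have {2}-> : x = \sum_(g <- s) gsub_hpr g x.
    by apply: val_inj; rewrite raddf_sum [LHS]e.
  apply: decI => // g; last exact: hpr_mem.
  by move=> /cs h; apply: val_inj.
- by move=> g x y; apply: val_inj; apply: hprD.
- by move=> g x hx; apply: val_inj; rewrite /= (hpr_hom (gmod_sum M) _ hx) eqxx.
- move=> g h x hx gh; apply: val_inj; rewrite /= (hpr_hom (gmod_sum M) _ hx).
  by case: eqP.
Qed.

Fact gsub_scale g h a x :
  gring_part g a -> gsub_part h x -> gsub_part (g + h) (a *: x).
Proof. exact: gmod_scale. Qed.

Definition gsub : gmod R := GModPack gsub_sum gsub_scale.

Fact is_gmor_gsub_val : is_gmor (M := gsub) (N := M) gsub_val.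
Proof. by split. Qed.

Definition gsub_incl : gmor gsub M := GMor (asboolT is_gmor_gsub_val).

End Submodule.

(** * Graded quotient modules *)

Section Quotient.
Variables (M : gmod R) (S : gsubmod M).

(** The quotient is taken as an additive group first; the action of [R] is then defined on
    representatives, using the stability of [S] under scaling. *)
Definition gquot_car : Type := Quotient.quot (gsubmod_pred S).
HB.instance Definition _ := GRing.Zmodule.on gquot_car.

Definition gquot_pi (x : M) : gquot_car := \pi_(Quotient.quot (gsubmod_pred S)) x.

Lemma gquot_piD x y : gquot_pi (x + y) = gquot_pi x + gquot_pi y.
Proof. by rewrite /gquot_pi; exact: Quotient.pi_add. Qed.

Lemma gquot_ind (P : gquot_car -> Prop) : (forall x, P (gquot_pi x)) -> forall q, P q.
Proof. by move=> h q; rewrite -[q]reprK; apply: h. Qed.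

Lemma gquot_piP x y : gquot_pi x = gquot_pi y <-> S (x - y).
Proof.
split=> [/eqP|h]; first by rewrite /gquot_pi -Quotient.idealrBE => /asboolP.
by apply/eqP; rewrite /gquot_pi -Quotient.idealrBE; apply/asboolP.
Qed.

Lemma gquot_repr x : S (repr (gquot_pi x) - x).
Proof. by apply/gquot_piP; rewrite /gquot_pi reprK. Qed.

Definition gquot_scale (a : R) (q : gquot_car) := gquot_pi (a *: repr q).

Lemma gquot_scaleE a x : gquot_scale a (gquot_pi x) = gquot_pi (a *: x).
Proof.
rewrite /gquot_scale; apply/gquot_piP; rewrite -scalerBr.
exact/gsubmodZ/gquot_repr.
Qed.

Fact gquot_scaleA a b q :
  gquot_scale a (gquot_scale b q) = gquot_scale (a * b) q.
Proof. by elim/gquot_ind: q => x; rewrite !gquot_scaleE scalerA. Qed.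

Fact gquot_scale1 : left_id 1 gquot_scale.
Proof. by elim/gquot_ind => x; rewrite gquot_scaleE scale1r. Qed.

Fact gquot_scaleDr : right_distributive gquot_scale +%R.
Proof.
move=> a; elim/gquot_ind=> x; elim/gquot_ind=> y.
by rewrite -gquot_piD !gquot_scaleE scalerDr gquot_piD.
Qed.

Fact gquot_scaleDl q : {morph gquot_scale^~ q : a b / a + b}.
Proof.
move=> a b; elim/gquot_ind: q => x.
by rewrite !gquot_scaleE scalerDl gquot_piD.
Qed.

HB.instance Definition _ := GRing.Zmodule_isLmodule.Build (gring_car R) gquot_car
  gquot_scaleA gquot_scale1 gquot_scaleDr gquot_scaleDl.

Lemma gquot_piZ a x : gquot_pi (a *: x) = a *: gquot_pi x.
Proof. exact/esym/gquot_scaleE. Qed.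

Lemma gquot_pi0 : gquot_pi 0 = 0.
Proof. by apply: (addrI (gquot_pi 0)); rewrite -gquot_piD !addr0. Qed.

Lemma gquot_pi_eq0 x : gquot_pi x = 0 <-> S x.
Proof. by rewrite -gquot_pi0 gquot_piP subr0. Qed.

Lemma gquot_piB x y : gquot_pi (x - y) = gquot_pi x - gquot_pi y.
Proof. by rewrite gquot_piD -scaleN1r gquot_piZ scaleN1r. Qed.

Definition gquot_part (g : G) : set gquot_car := gquot_pi @` gmod_part M g.

(** The choice of representative is harmless because [S] is stable under taking components. *)
Definition gquot_hpr g (q : gquot_car) := gquot_pi (hpr (gmod_sum M) g (repr q)).

Lemma gquot_hprE g x :
  gquot_hpr g (gquot_pi x) = gquot_pi (hpr (gmod_sum M) g x).
Proof.
by rewrite /gquot_hpr; apply/gquot_piP; rewrite -hprB; apply/gsubmod_hpr/gquot_repr. Qed.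

Fact gquot_sum : is_direct_sum gquot_part.
Proof.
have hs g : is_subgroup (gquot_part g).
  split; first by exists 0; [apply: (part_sub M g).1 | apply: gquot_pi0].
  move=> _ _ [x hx <-] [y hy <-]; exists (x - y); last exact: gquot_piB.
  exact: (part_sub M g).2.
apply: (direct_sum_pr (p := gquot_hpr)) => //.
- elim/gquot_ind => x; have [s [us cs e]] := decE (hpr_dec (gmod_sum M) x).
  exists (fun g => gquot_pi (hpr (gmod_sum M) g x)).
  rewrite {2}e (big_morph gquot_pi gquot_piD gquot_pi0).
  apply: decI => // g; first by move/cs ->; rewrite gquot_pi0.
  by exists (hpr (gmod_sum M) g x) => //; apply: hpr_mem.
- move=> g; elim/gquot_ind=> x; elim/gquot_ind=> y.
  by rewrite -gquot_piD !gquot_hprE hprD gquot_piD.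
- by move=> g _ [x hx <-]; rewrite gquot_hprE (hpr_hom (gmod_sum M) _ hx) eqxx.
- move=> g h _ [x hx <-] gh; rewrite gquot_hprE (hpr_hom (gmod_sum M) _ hx).
  by case: eqP; rewrite // gquot_pi0.
Qed.

Fact gquot_partZ g h a q :
  gring_part g a -> gquot_part h q -> gquot_part (g + h) (a *: q).
Proof.
move=> ha [x hx <-]; exists (a *: x); first exact: gmod_scale.
exact: gquot_piZ.
Qed.

Definition gquot : gmod R := GModPack gquot_sum gquot_partZ.

Fact is_gmor_gquot_pi : is_gmor (M := M) (N := gquot) gquot_pi.
Proof.
split; first by move=> a x y; rewrite gquot_piD gquot_piZ.
by move=> g x hx; exists x.
Qed.

Definition gquot_proj : gmor M gquot := GMor (asboolT is_gmor_gquot_pi).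

End Quotient.

(** * Kernels, images and sections of surjections *)

Section Kernel.
Variables (M N : gmod R) (f : gmor M N).

Definition gker : gsubmod M.
Proof.
apply: (@GSubmod _ [set x | f x = 0]) => [|x y|a x|g x] /=.
- exact: gmor0.
- by rewrite gmorD => -> ->; rewrite addr0.
- by rewrite gmorZ => ->; rewrite scaler0.
- by rewrite -hpr_gmor => ->; apply: hpr0.
Defined.

Definition gimage : gsubmod N.
Proof.
apply: (@GSubmod _ (range f)) => [|_ _ [x _ <-] [y _ <-]|a _ [x _ <-]|g _ [x _ <-]].
- by exists 0 => //; apply: gmor0.
- by exists (x + y) => //; apply: gmorD.
- by exists (a *: x) => //; apply: gmorZ.
- by exists (hpr (gmod_sum M) g x) => //; rewrite hpr_gmor.
Defined.

End Kernel.

(* An epimorphism f : M -> N is tested on the projection N -> N / f(M) and 0. *)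
Lemma epi_surj M N (f : gmor M N) : is_epi f -> forall y, exists x, f x = y.
Proof.
move=> ef y.
have e : gquot_proj (gimage f) = 0.
  apply: ef; apply: gmor_eq => x /=; apply/gquot_pi_eq0.
  by exists x.
have /gquot_pi_eq0[x _ <-] : gquot_pi (gimage f) y = 0.
  by have := congr1 (fun h : gmor N (gquot (gimage f)) => h y) e.
by exists x.
Qed.

(** Exactness of Hom([P], -) on 0 -> ker [p] -> [M] -> [P] -> 0 makes composition with [p]
    surjective onto Hom([P], [P]); a section is a preimage of the identity. *)
Lemma projective_section P M (p : gmor M P) : is_projective P ->
  (forall y, exists x, p x = y) -> exists s : gmor P M, gcomp p s = gid P.
Proof.
move=> pP ps.
have ex : short_exact (gsub_incl (gker p)) p.
  split=> [x y|| ]; first exact: val_inj.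
  - apply/seteqP; split=> [_ [x _ <-]|x hx].
      by case: x => x /= /asboolP.
    have kx : x \in gsubmod_pred (gker p) by apply/asboolP.
    by exists (GSub kx).
  - by apply/seteqP; split=> // y _; have [x <-] := ps y; exists x.
have [_ _ sur] := pP _ _ _ _ _ ex.
have : [set: gmor P P] (gid P) by [].
by rewrite -sur => -[s _ <-]; exists s.
Qed.

(* The direct sum of the R(d i), as the functions of finite support; the generator
   at i has degree - d i. *)
Section InfiniteFree.
Variables (I : choiceType) (d : I -> G).

Definition finsupp_pred : {pred I -> (gring_car R)^o} :=
  fun x => `[< exists s : seq I, forall i, i \notin s -> x i = 0 >].

Fact finsupp_closed : subsemimod_closed finsupp_pred.
Proof.
split; first (split; first by apply/asboolP; exists [::]).
  move=> x y /asboolP[s hs] /asboolP[t ht]; apply/asboolP; exists (s ++ t) => i.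
  rewrite mem_cat negb_or => /andP[/hs xi /ht yi].
  by rewrite -[LHS]/(x i + y i) xi yi addr0.
move=> a x /asboolP[s hs]; apply/asboolP; exists s => i /hs xi.
by rewrite -[LHS]/(a *: x i) xi scaler0.
Qed.

HB.instance Definition _ := GRing.isSubmodClosed.Build (gring_car R)
  (I -> (gring_car R)^o) finsupp_pred finsupp_closed.

Record gfin_car := GFin {
  gfin_val :> I -> (gring_car R)^o; _ : gfin_val \in finsupp_pred }.

HB.instance Definition _ := [isSub for gfin_val].
HB.instance Definition _ := [Choice of gfin_car by <:].
HB.instance Definition _ := [SubChoice_isSubLmodule of gfin_car by <:].

Definition gfin_part (g : G) : set gfin_car :=
  [set x | forall i, gmod_part (shift (gregular R) (d i)) g (x i)].

Lemma gfin_eq (x y : gfin_car) : x =1 y -> x = y.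
Proof. by move=> e; apply/val_inj/funext. Qed.

Fact gfin_single_subproof i (a : (gring_car R)^o) :
  (fun j => if j == i then a else 0) \in finsupp_pred.
Proof.
by apply/asboolP; exists [:: i] => j; rewrite inE => /negbTE ->.
Qed.

Definition gfin_single i a := GFin (gfin_single_subproof i a).

Lemma gfin_sumE (s : seq I) (F : I -> gfin_car) j :
  (\sum_(i <- s) F i) j = \sum_(i <- s) F i j.
Proof. by elim: s => [|i s ih]; rewrite ?big_nil // !big_cons -ih. Qed.

Lemma gfin_support (x : gfin_car) :
  exists2 s, uniq s & forall i, i \notin s -> x i = 0.
Proof.
have /asboolP[s hs] := valP x; exists (undup s); first exact: undup_uniq.
by move=> i; rewrite mem_undup => /hs.
Qed.

(** Splitting by index reduces a claim about finitely supported functions to one summand R([d i]),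
    as in [gfin_sum]; it also gives the expansion in the standard dual basis. *)
Lemma gfin_decomposition (x : gfin_car) :
  decomposition (fun=> setT) (fun i => gfin_single i (x i)) x.
Proof.
have [s us hs] := gfin_support x.
have {2}-> : x = \sum_(i <- s) gfin_single i (x i).
  apply: gfin_eq => j; rewrite gfin_sumE /=.
  case: (boolP (j \in s)) => js; last first.
    rewrite hs // big_seq big1 // => i si; case: eqP => // ji.
    by rewrite ji si in js.
  rewrite (bigD1_seq j) //= eqxx big1 ?addr0 // => i ij.
  by rewrite eq_sym (negbTE ij).
apply: decI => // i /hs xi; apply: gfin_eq => j /=.
by rewrite xi; case: eqP.
Qed.

Fact gfin_hpr_subproof g (x : gfin_car) :
  (fun i => hpr (gmod_sum (shift (gregular R) (d i))) g (x i)) \in finsupp_pred.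
Proof.
have [s _ hs] := gfin_support x; apply/asboolP; exists s => i /hs ->.
exact: hpr0.
Qed.

Definition gfin_hpr g x := GFin (gfin_hpr_subproof g x).

Fact gfin_sum : is_direct_sum gfin_part.
Proof.
have hs g : is_subgroup (gfin_part g).
  split=> [i|x y hx hy i]; first exact: (part_sub (shift (gregular R) (d i)) g).1.
  exact: (part_sub (shift (gregular R) (d i)) g).2.
apply: (direct_sum_pr (p := gfin_hpr)) => //.
(* Having a homogeneous decomposition is preserved by sums, so it suffices to treat one coordinate,
   and there one homogeneous scalar. *)
- move=> x; have [s [_ _ ->]] := decE (gfin_decomposition x).
  apply: (big_ind (fun y => exists c, decomposition gfin_part c y)).
  + by exists (fun=> 0); apply: dec0.
  + by move=> y z [c hc] [c' hc']; exists (fun h => c h + c' h); apply: decD.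
  move=> i _; move: (x i).
  apply: (Defs.hom_ind (gmod_sum (shift (gregular R) (d i)))).
  + exists (fun=> 0); have -> : gfin_single i 0 = 0.
      by apply: gfin_eq => j /=; case: eqP.
    exact: dec0.
  + move=> a b [c hc] [c' hc']; exists (fun h => c h + c' h).
    have -> : gfin_single i (a + b) = gfin_single i a + gfin_single i b.
      apply: gfin_eq => j.
      rewrite -[RHS]/(gfin_single i a j + gfin_single i b j) /=.
      by case: eqP; rewrite ?addr0.
    exact: decD.
  + move=> g a ha; eexists; apply: (dec_single (h := g)) => // j /=.
    case: eqP => [->|_] //; exact: (part_sub (shift (gregular R) (d j)) g).1.
- by move=> g x y; apply: gfin_eq => i; apply: hprD.
- move=> g x hx; apply: gfin_eq => i /=.
  by rewrite (hpr_hom (gmod_sum (shift (gregular R) (d i))) _ (hx i)) eqxx.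
- move=> g h x hx gh; apply: gfin_eq => i /=.
  by rewrite (hpr_hom (gmod_sum (shift (gregular R) (d i))) _ (hx i)); case: eqP.
Qed.

Fact gfin_scale g h a x :
  gring_part g a -> gfin_part h x -> gfin_part (g + h) (a *: x).
Proof. by move=> ha hx i; apply: gmod_scale. Qed.

Definition gfin : gmod R := GModPack gfin_sum gfin_scale.

(** * Morphisms out of a free graded module *)

Section Lift.
Variables (M : gmod R) (e : I -> M).
Hypothesis he : forall i, gmod_part M (- d i) (e i).

Definition gfin_lift_fun (x : gfin) : M := \sum_(i \in [set: I]) x i *: e i.

(** The list may exceed the support, so that several elements can be summed over one common list. *)
Lemma gfin_lift_seq (x : gfin) (s : seq I) : uniq s ->
  (forall i, i \notin s -> x i = 0) ->
  gfin_lift_fun x = \sum_(i <- s) x i *: e i.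
Proof. by move=> us hs; apply: fsum_seq => // i /hs ->; apply: scale0r. Qed.

Lemma gfin_lift_single i a : gfin_lift_fun (gfin_single i a) = a *: e i.
Proof.
rewrite (@gfin_lift_seq _ [:: i]) ?big_seq1 //= ?eqxx // => j.
by rewrite inE => /negbTE ->.
Qed.

Fact is_gmor_gfin_lift : is_gmor gfin_lift_fun.
Proof.
split=> [a x y|g x hx]; last first.
  have [s us hs] := gfin_support x; rewrite (gfin_lift_seq us hs).
  apply: (subgroup_sum _ (part_sub M g)) => i.
  (* Degree [g] in R([d i]) is degree [d i + g] in [R], and the degree [- d i] of [e i] cancels the
     shift. *)
  have := gmod_scale (hx i : gring_part (d i + g) (x i)) (he i).
  by rewrite addrAC subrr add0r.
have [s us hs] := gfin_support x; have [t ut ht] := gfin_support y.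
have ust : uniq (undup (s ++ t)) by apply: undup_uniq.
have xs i : i \notin undup (s ++ t) -> x i = 0.
  by rewrite mem_undup mem_cat negb_or => /andP[/hs].
have ys i : i \notin undup (s ++ t) -> y i = 0.
  by rewrite mem_undup mem_cat negb_or => /andP[_ /ht].
rewrite (gfin_lift_seq ust xs) (gfin_lift_seq ust ys) scaler_sumr.
rewrite (@gfin_lift_seq (a *: x + y) _ ust) => [|i hi]; last first.
  by rewrite -[LHS]/(a *: x i + y i) xs // ys // scaler0 addr0.
rewrite -big_split /=; apply: eq_bigr => i _.
by rewrite -[_ i]/(a * x i + y i) scalerDl scalerA.
Qed.

Definition gfin_lift : gmor gfin M := GMor (asboolT is_gmor_gfin_lift).

End Lift.

End InfiniteFree.

(* Each f i is homogeneous of degree opposite to that of e i; decomposing in the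
   trivial family of subgroups says that (f i x) is finitely supported and that
   the sum of the (f i x) *: (e i) is x. *)
Definition dual_basis M (I : choiceType) (d : I -> G) (e : I -> M)
    (f : I -> ghom M (gregular R)) : Prop :=
  [/\ forall i, gmod_part M (- d i) (e i),
      forall i, ghom_part (d i) (f i)
    & forall x, decomposition (fun=> setT) (fun i => (f i x : R) *: e i) x].

(** * Construction of dual bases *)

Lemma decomposition_gmor M N (p : gmor M N) (I : choiceType) (c : I -> M) x :
  decomposition (fun=> setT) c x ->
  decomposition (fun=> setT) (fun i => p (c i)) (p x).
Proof.
move=> hc; have [s [us cs ->]] := decE hc; rewrite gmor_sum.
by apply: decI => // i /cs ->; rewrite gmor0.
Qed.

(** Push the elements forward along [p] and precompose the forms with [s]: applying [p] to the
    expansion of [s x] gives that of [x]. *)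
Lemma dual_basis_retract M N (p : gmor M N) (s : gmor N M) (I : choiceType)
    (d : I -> G) (e : I -> M) (f : I -> ghom M (gregular R)) :
  gcomp p s = gid N -> dual_basis d e f ->
  exists (e' : I -> N) (f' : I -> ghom N (gregular R)), dual_basis d e' f'.
Proof.
move=> ps [he hf hd].
have hs i : is_homog (M := N) (N := gregular R) (d i) (f i \o s).
  exact: is_gmor_comp (GMor (asboolT (hf i : is_gmor (N := shift _ _) _))) s.
exists (p \o e), (fun i => GHom (is_ghom_homog (hs i))); split=> // [i|x].
  exact: (gmorP p).2.
have psx : p (s x) = x by have := congr1 (fun h : gmor N N => h x) ps.
have := decomposition_gmor p (hd (s x)); rewrite psx.
congr (decomposition _ _ _); apply/funext => i; exact: gmorZ.
Qed.

(* The component of degree 0 of 1 is a unit element: for a homogeneous of degree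
   g, multiplication by a is a morphism R -> R(g), so it commutes with taking the
   component of degree 0. *)
Lemma gring_part1 : gring_part 0 (1 : R).
Proof.
pose r0 : gregular R := hpr (gmod_sum (gregular R)) 0 (1 : gregular R).
have h0 (a : gregular R) : (a : R) * (r0 : R) = a.
  move: a; apply: (Defs.hom_ind (gring_sum R)) => [|a b ha hb|g a ha].
  - exact: mul0r.
  - by rewrite mulrDl ha hb.
  have hm : is_gmor (M := gregular R) (N := shift (gregular R) g)
      (fun x : R => a * x).
    split=> [b x y|h x hx]; last exact: (gring_mul ha hx).
    by rewrite mulrDr -[b *: _]/(b * _) mulrCA.
  pose m := GMor (asboolT hm); have e := hpr_gmor m 0 (1 : gregular R).
  rewrite -[RHS](_ : m 1 = a); last exact: mulr1.
  rewrite -[LHS]e (hpr_hom _ (h := 0)) ?eqxx //= mulr1.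
  by rewrite /shift_part addr0.
have <- : (r0 : R) = 1 by rewrite -[LHS]mul1r h0.
exact: hpr_mem.
Qed.

(** The standard generators, with the coordinates as forms. The generator at [i] has degree [- d i]
    since R([d i]) in that degree is the degree 0 part of [R], which contains 1. *)
Lemma dual_basis_gfin (I : choiceType) (d : I -> G) :
  exists e f, @dual_basis (gfin d) I d e f.
Proof.
have hf i : is_homog (M := gfin d) (N := gregular R) (d i) (fun x => x i).
  by split=> // g x hx; apply: hx.
exists ((gfin_single (I := I))^~ 1), (fun i => GHom (is_ghom_homog (hf i))).
split=> // [i j /=|x].
  case: eqP => [->|_]; last exact: (part_sub (shift (gregular R) _) _).1.
  by rewrite /shift_part subrr; exact: gring_part1.
have := gfin_decomposition x; congr (decomposition _ _ _); apply/funext => i.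
apply: gfin_eq => j; rewrite -[RHS]/(x i * gfin_single i 1 j) /=.
by case: eqP; rewrite ?mulr1 ?mulr0.
Qed.

Lemma dual_basis_gfree (I : finType) (d : I -> G) :
  exists e f, @dual_basis (gfree R d) I d e f.
Proof.
have hf i : is_homog (M := gfree R d) (N := gregular R) (d i)
    (fun x : gfree R d => (x : {ffun I -> (gring_car R)^o}) i).
  by split=> [a x y|g x hx]; [rewrite !ffunE | apply: hx].
exists (fun i => [ffun j => if j == i then 1 else 0]).
exists (fun i => GHom (is_ghom_homog (hf i))); split=> // [i j /=|x].
  rewrite ffunE; case: eqP => [->|_].
    by rewrite /shift_part subrr; exact: gring_part1.
  exact: (part_sub (shift (gregular R) _) _).1.
set c := (X in decomposition _ X _); suff -> : x = \sum_(i <- enum I) c i.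
  by apply: decI; rewrite ?enum_uniq // => i; rewrite mem_enum.
apply/ffunP => j; rewrite big_enum /= sum_ffunE (bigD1 j) //= big1 => [|i ij].
  by rewrite /c /= !ffunE eqxx addr0 -[_ *: _]/(_ * _) mulr1.
by rewrite /c /= !ffunE eq_sym (negbTE ij) scaler0.
Qed.

(* The covering free module has one generator for each pair (g, x), mapped to the
   component of degree g of x; its degree -(d i) is g. *)
Lemma projective_dual_basis M : is_projective M ->
  exists (I : choiceType) (d : I -> G) e f, @dual_basis M I d e f.
Proof.
move=> pM; pose d (i : G * M) := - i.1.
pose e (i : G * M) := hpr (gmod_sum M) i.1 i.2.
have he i : gmod_part M (- d i) (e i) by rewrite opprK; apply: hpr_mem.
have sur y : exists x, gfin_lift he x = y.
  move: y; apply: (Defs.hom_ind (gmod_sum M)).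
  - by exists 0; apply: gmor0.
  - by move=> _ _ [x <-] [y <-]; exists (x + y); apply: gmorD.
  - move=> g x hx; exists (gfin_single (g, x) 1).
    by rewrite /= gfin_lift_single scale1r /e (hpr_hom (gmod_sum M) _ hx) eqxx.
have [s hs] := projective_section pM sur.
have [e0 [f0 h0]] := dual_basis_gfin d.
have [e1 [f1 h1]] := dual_basis_retract hs h0.
by exists (G * M)%type, d, e1, f1.
Qed.

(** An epimorphism from a finite free module is surjective, hence split because [M] is projective,
    and the finite standard dual basis passes to the retract. *)
Lemma projective_finite_dual_basis M : is_projective M -> is_finite_type M ->
  exists (I : finType) (d : I -> G) e f, @dual_basis M I d e f.
Proof.
move=> pM [I [d [F [[i [i' [i'i _]]] [p ep]]]]].
have sur y : exists x, gcomp p i' x = y.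
  (* A preimage under [p] is carried to the free module by [i], and [i'] brings it back. *)
  have [x <-] := epi_surj ep y; exists (i x).
  have i'ix : i' (i x) = x := congr1 (fun h : gmor F F => h x) i'i.
  by rewrite -{2}i'ix.
have [s hs] := projective_section pM sur.
have [e0 [f0 h0]] := dual_basis_gfree d.
have [e1 [f1 h1]] := dual_basis_retract hs h0.
by exists I, d, e1, f1.
Qed.

(** * Injectivity of the canonical morphism *)

Section DualBasis.
Variables (M N : gmod R) (I : choiceType) (d : I -> G) (e : I -> M).
Variable f : I -> ghom M (gregular R).
Hypothesis hb : dual_basis d e f.

(** The terms are additive in [t], so a pure tensor suffices; there the scalar [f i x] moves from
    [y] to [e i] across the tensor sign, and the terms add up by the expansion of [x]. *)
Lemma mu_decomposition (t : gtensor M N) :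
  decomposition (fun=> setT) (fun i => pure (e i) (mu M N t (f i))) t.
Proof.
have [_ _ hd] := hb; move: t; apply: tens_pure_ind.
- rewrite gmor0.
  have := @dec0 I (gtensor M N) (fun=> setT) (fun=> setT_subgroup _).
  congr (decomposition _ _ _); apply/funext => i; exact/esym/pure0r.
- move=> t u ht hu; have := decD (fun=> setT_subgroup _) ht hu.
  congr (decomposition _ _ _); apply/funext => i.
  have -> : mu M N (t + u) (f i) = mu M N t (f i) + mu M N u (f i).
    by rewrite gmorD.
  by rewrite pureDr.
move=> x y; have [s [us cs ex]] := decE (hd x).
have -> : (fun i => pure (e i) (mu M N (pure x y) (f i))) =
    (fun i => pure ((f i x : R) *: e i) y).
  by apply/funext => i; rewrite mu_pure pureZl pureZr.
have -> : pure x y = \sum_(i <- s) pure ((f i x : R) *: e i) y.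
  rewrite {1}ex; apply: (big_morph (fun z : M => pure z y)).
    by move=> z z'; apply: pureDl.
  exact: pure0l.
by apply: decI => // i /cs ->; apply: pure0l.
Qed.

(** If [t] and [u] have the same image, every term in the expansion of [t - u] vanishes. *)
Lemma mu_inj : injective (mu M N).
Proof.
move=> t u h; apply/eqP; rewrite -subr_eq0; apply/eqP.
have [s [_ _ ->]] := decE (mu_decomposition (t - u)).
by rewrite big1 // => i _; rewrite gmorB h subrr pure0r.
Qed.

End DualBasis.

(** * The inverse for a finite dual basis *)

Section FiniteDualBasis.
Variables (M N : gmod R) (I : finType) (d : I -> G) (e : I -> M).
Variable f : I -> ghom M (gregular R).
Hypothesis hb : dual_basis d e f.

Let Mdual := ghom M (gregular R).

(** The expansion of [mu_decomposition] with [mu M N t] replaced by an arbitrary [phi]; finiteness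
    of [I] gives the sum a meaning for every [phi]. *)
Definition mu_inv_fun (phi : ghom Mdual N) : gtensor M N :=
  \sum_i pure (e i) (phi (f i)).

Fact is_gmor_mu_inv : is_gmor mu_inv_fun.
Proof.
have [he hf _] := hb; split=> [a u v|g u hu].
  rewrite /mu_inv_fun scaler_sumr -big_split; apply: eq_bigr => i _.
  have -> : (a *: u + v) (f i) = a *: u (f i) + v (f i) by [].
  by rewrite pureDr pureZr.
apply: (subgroup_sum _ (part_sub (gtensor M N) g)) => i.
(* The degree [d i] of the form cancels the degree [- d i] of [e i] in the tensor. *)
have hui : gmod_part N (g + d i) (u (f i)) := hu.2 _ _ (hf i).
have := pure_part (he i) hui.
by rewrite addrCA addNr addr0.
Qed.

Definition mu_inv : gmor (ghom Mdual N) (gtensor M N) :=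
  GMor (asboolT is_gmor_mu_inv).

Lemma muK : cancel (mu M N) mu_inv.
Proof. by move=> t; exact/esym/decomposition_fin_sum/(mu_decomposition hb). Qed.

Lemma mu_invK : cancel mu_inv (mu M N).
Proof.
move=> phi; apply: ghom_eq => u; have [_ _ hd] := hb.
(* The [f i] generate the dual: apply [u] to the expansion of each [x]. *)
have {2}-> : u = \sum_i (u (e i) : R) *: f i.
  apply: ghom_eq => x; rewrite {1}(decomposition_fin_sum (hd x)) ghom_lsum ghom_sumE.
  by apply: eq_bigr => i _; rewrite [LHS]mulrC.
(* Both sides become the sum of the [u (e i) *: phi (f i)], the right one by linearity of [phi]. *)
rewrite gmor_sum ghom_sumE ghom_lsum; apply: eq_bigr => i _; exact: mu_pure.
Qed.

Lemma mu_iso : is_iso (mu M N).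
Proof.
exists mu_inv; split; apply: gmor_eq; [exact: muK|exact: mu_invK].
Qed.

End FiniteDualBasis.

End GradedModules.

Theorem mainTheorem11 (G : zmodType) (R : gring G) (M N : gmod R) :
  (is_projective M -> is_projective N -> is_mono (mu M N)) /\
  (is_projective M -> is_finite_type M -> is_iso (mu M N)).
Proof.
split=> [pM _ P u v uv|pM fM]; last first.
  have [I [d [e [f hb]]]] := projective_finite_dual_basis pM fM.
  exact: (mu_iso N hb).
have [I [d [e [f hb]]]] := projective_dual_basis pM.
apply: gmor_eq => x; apply: (mu_inj hb).
exact: (congr1 (fun h : gmor P _ => h x) uv).
Qed.
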